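(* Let $\{P_t\}_{t\geq 0}$ be a Markov--Feller semigroup on a Polish space $\mathcal{X}$ which is Ces\`aro eventually continuous at every point of $\mathcal{X}$, and suppose it admits an ergodic invariant measure $\mu$. Then for every $x\in\operatorname{supp}\mu$, $Q_t(x,\cdot)$ converges weakly to $\mu$ as $t\to\infty$.
   Context: $(\mathcal{X},\rho)$ is a Polish space; $\mathcal{P}(\mathcal{X})$ denotes Borel probability measures; $C_b(\mathcal{X})$, $L_b(\mathcal{X})$ denote bounded continuous and bounded Lipschitz real functions. A Markov--Feller semigroup $\{P_t\}_{t\ge0}$ is a semigroup of mass-preserving positively linear operators on finite Borel measures, each having a dual linear operator on bounded Borel functions ($\langle f,P_t\mu\rangle=\langle P_tf,\mu\rangle$) which maps $C_b(\mathcal{X})$ into itself. For $t>0$: $Q_tf(x)=\frac1t\int_0^tP_sf(x)\,ds$, $Q_t(x,\cdot)=\frac1t\int_0^tP_s\delta_x\,ds$. An invariant measure is $\mu\in\mathcal{P}(\mathcal{X})$ with $P_t\mu=\mu$ for all $t$; ergodic means ergodic in the usual sense (extremal among invariant probability measures). Weak convergence means convergence of $\langle f,\cdot\rangle$ for all $f\in C_b(\mathcal{X})$. Ces\`aro eventually continuous at $z$: for every $f\in L_b(\mathcal{X})$, $\limsup_{x\to z}\limsup_{t\to\infty}|Q_tf(x)-Q_tf(z)|=0$. *)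

(* Defs.v *)
From HB Require Import structures.
From mathcomp Require Import all_boot all_order all_algebra.
From mathcomp Require Import all_classical all_reals all_analysis.
From mathcomp Require Import measurable_realfun.
Set Implicit Arguments. Unset Strict Implicit. Unset Printing Implicit Defensive.
Import Order.TTheory GRing.Theory Num.Theory.
Import numFieldNormedType.Exports.
Local Open Scope classical_set_scope.
Local Open Scope ring_scope.

Notation borel X := (g_sigma_algebraType (@open X)).

Definition polish_metric (R : realType) (X : completePseudoMetricType R)
    (rho : X -> X -> R) : Prop :=
  [/\ (forall x y, 0 <= rho x y),
      (forall x y, rho x y = 0 <-> x = y),
      (forall x y, rho x y = rho y x),
      (forall x y z, rho x z <= rho x y + rho y z) &
      (forall (x : X) (r : R), ball x r = [set y | rho x y < r])] /\
  (exists D : set X, countable D /\ dense D).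

Definition bounded_continuous (R : realType) (X : ptopologicalType)
    (f : X -> R) : Prop :=
  continuous f /\ exists M : R, forall x, `|f x| <= M.

Definition bounded_lipschitz (R : realType) (X : Type) (rho : X -> X -> R)
    (f : X -> R) : Prop :=
  (exists M : R, forall x, `|f x| <= M) /\
  (exists L : R, forall x y, `|f x - f y| <= L * rho x y).

Definition Pf (R : realType) (X : ptopologicalType)
    (P : R -> R.-pker (borel X) ~> (borel X)) (t : R) (f : X -> R) (x : X) : R :=
  Rintegral (P t x) [set: borel X] f.

Definition Qf (R : realType) (X : ptopologicalType)
    (P : R -> R.-pker (borel X) ~> (borel X)) (t : R) (f : X -> R) (x : X) : R :=
  t^-1 * Rintegral (@lebesgue_measure R) `[0, t] (fun s => Pf P s f x).

(* Markov--Feller semigroup, described through its transition probabilities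
   P t x = P_t delta_x (a probability kernel for each t). *)
Definition markov_feller (R : realType) (X : ptopologicalType)
    (P : R -> R.-pker (borel X) ~> (borel X)) : Prop :=
  [/\
      (forall (x : X) (A : set (borel X)), measurable A ->
          P 0 x A = \d_(x : borel X) A),
      (forall s t : R, 0 <= s -> 0 <= t ->
        forall (x : X) (A : set (borel X)), measurable A ->
          P (s + t) x A = (\int[P s x]_y P t y A)%E),
      (forall t : R, 0 <= t -> forall f : X -> R,
          bounded_continuous f -> continuous (Pf P t f)) &
      (* time measurability, needed for Q_t to be defined *)
      (forall (x : X) (A : set (borel X)), measurable A ->
          measurable_fun (`[0, +oo[%classic : set R) (fun s : R => P s x A))].

Definition invariant (R : realType) (X : ptopologicalType)
    (P : R -> R.-pker (borel X) ~> (borel X)) (mu : probability (borel X) R)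
    : Prop :=
  forall t : R, 0 <= t -> forall A : set (borel X), measurable A ->
    (\int[mu]_x P t x A)%E = mu A.

Definition ergodic (R : realType) (X : ptopologicalType)
    (P : R -> R.-pker (borel X) ~> (borel X)) (mu : probability (borel X) R)
    : Prop :=
  invariant P mu /\
  forall (nu1 nu2 : probability (borel X) R) (l : R), 0 < l < 1 ->
    invariant P nu1 -> invariant P nu2 ->
    (forall A : set (borel X), measurable A ->
       mu A = (l%:E * nu1 A + (1 - l)%:E * nu2 A)%E) ->
    forall A : set (borel X), measurable A -> nu1 A = mu A /\ nu2 A = mu A.

Definition supp (R : realType) (X : ptopologicalType)
    (mu : probability (borel X) R) : set X :=
  [set x | forall U : set X, open U -> U x -> (0 < mu U)%E].

Definition cesaro_ev_continuous (R : realType) (X : ptopologicalType)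
    (rho : X -> X -> R) (P : R -> R.-pker (borel X) ~> (borel X)) (z : X)
    : Prop :=
  forall f : X -> R, bounded_lipschitz rho f ->
    limf_esup (fun x : X =>
      limf_esup (fun t : R => (`|Qf P t f x - Qf P t f z|)%:E) (pinfty_nbhs R))
      (nbhs z) = 0%E.

(* Main.v *)
(** To show that [Q_t f x --> mu f] for [f] bounded Lipschitz and [x] in the
    support of [mu], average over a small ball [B] around [x], on which [Q_t f]
    is eventually close to [Q_t f x] by Cesaro eventual continuity (dominated
    convergence makes this uniform enough), and which has positive measure.
    It then suffices that [mu (1_B * Q_t f) / mu B --> mu f].

    No mean ergodic theorem is needed for that.  The functionals
    [g |-> mu (1_B * Q_t g) / mu B] on bounded measurable functions are positive,
    unital and dominated by [mu / mu B]; every ultralimit as [t --> +oo] inherits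
    this, and domination makes it integration against a probability [nu], which
    is invariant because time averages are asymptotically shift-invariant.  As
    [mu - (mu B / 2) nu >= 0] is invariant too, extremality of [mu] forces
    [nu = mu].

    Bounded continuous functions are reached from below by Lipschitz ones
    through inf-convolution.  The same approximation, applied to indicators of
    open sets, gives the joint measurability of [(s, y) |-> P_s(y, A)] which
    Fubini requires, since a function measurable in [s] and continuous in [y] is
    jointly measurable. *)
Require Import Defs.
From HB Require Import structures.
From mathcomp Require Import all_boot all_order all_algebra.
From mathcomp Require Import all_classical all_reals all_analysis.
From mathcomp Require Import measurable_realfun.
From mathcomp Require Import ring lra.
Import Order.TTheory GRing.Theory Num.Theory.
Import numFieldNormedType.Exports.
Local Open Scope classical_set_scope.
Local Open Scope ring_scope.
Set Implicit Arguments.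
Unset Strict Implicit.
Unset Printing Implicit Defensive.

(** * Bounded measurable functions and their means *)

(** Such functions are integrable against every measure of mass 1, so real-valued integrals are
    linear and monotone on them without further side conditions. *)
Definition bounded_measurable d (T : measurableType d) (R : realType)
    (f : T -> R) : Prop :=
  measurable_fun setT f /\ exists M : R, forall x, `|f x| <= M.

Section bounded_measurable.
Context d (T : measurableType d) (R : realType).
Implicit Types f g : T -> R.

Lemma bounded_measurable_cst (c : R) : bounded_measurable (fun _ : T => c).
Proof. by split; [exact: measurable_cst|exists `|c|]. Qed.

Lemma bounded_measurableD f g : bounded_measurable f -> bounded_measurable g ->
  bounded_measurable (fun x => f x + g x).
Proof.
move=> [mf [M fM]] [mg [N gN]]; split; first exact: measurable_funD.
by exists (M + N) => x; rewrite (le_trans (ler_normD _ _))// lerD.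
Qed.

Lemma bounded_measurableM f g : bounded_measurable f -> bounded_measurable g ->
  bounded_measurable (fun x => f x * g x).
Proof.
move=> [mf [M fM]] [mg [N gN]]; split; first exact: measurable_funM.
by exists (M * N) => x; rewrite normrM ler_pM.
Qed.

Lemma bounded_measurableZ (c : R) f : bounded_measurable f ->
  bounded_measurable (fun x => c * f x).
Proof. by move=> bf; apply: bounded_measurableM => //; exact: bounded_measurable_cst. Qed.

Lemma bounded_measurableB f g : bounded_measurable f -> bounded_measurable g ->
  bounded_measurable (fun x => f x - g x).
Proof.
move=> bf bg; have -> : (fun x => f x - g x) = (fun x => f x + (-1) * g x).
  by apply/funext => x; rewrite mulN1r.
by apply: bounded_measurableD => //; exact: bounded_measurableZ.
Qed.

Lemma bounded_measurable_norm f : bounded_measurable f ->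
  bounded_measurable (fun x => `|f x|).
Proof.
move=> [mf [M fM]]; split; first exact: measurableT_comp.
by exists M => x; rewrite normr_id.
Qed.

Lemma bounded_measurable_indic (A : set T) : measurable A ->
  bounded_measurable (\1_A : T -> R).
Proof.
move=> mA; split; first exact: measurable_indic.
by exists 1 => x; rewrite indicE; case: (_ \in _); rewrite ?normr1 ?normr0.
Qed.

Lemma bounded_measurable_sum n (F : nat -> T -> R) :
  (forall i, bounded_measurable (F i)) ->
  bounded_measurable (fun x => \sum_(i < n) F i x).
Proof.
move=> bF; elim: n => [|n IH].
  under eq_fun do rewrite big_ord0; exact: bounded_measurable_cst.
under eq_fun do rewrite big_ord_recr/=; exact: bounded_measurableD.
Qed.

Lemma bounded_measurable_comp d' (T' : measurableType d') (h : T' -> T) f :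
  measurable_fun setT h -> bounded_measurable f ->
  bounded_measurable (f \o h).
Proof.
move=> mh [mf [M fM]]; split; first exact: measurableT_comp.
by exists M => x; exact: fM.
Qed.

End bounded_measurable.

Local Notation mean m f := (Rintegral m setT f).

Section mean.
Context d (T : measurableType d) (R : realType).
Variable m : {measure set T -> \bar R}.
Hypothesis m1 : m setT = 1%E.
Implicit Types f g : T -> R.

Lemma bounded_measurable_integrable f : bounded_measurable f ->
  m.-integrable setT (EFin \o f).
Proof.
move=> [mf [M fM]]; apply: (@le_integrable _ _ _ m setT measurableT _ (EFin \o cst M)).
- exact/measurable_EFinP.
- by move=> x _ /=; rewrite lee_fin (le_trans (fM x))// ler_norm.
- apply/integrableP; split; first exact/measurable_EFinP.
  by rewrite /= integral_cst// m1 mule1 ltry.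
Qed.

Let itg := bounded_measurable_integrable.

Lemma mean_cst (c : R) : mean m (fun _ => c) = c.
Proof. by rewrite Rintegral_cst// m1 mulr1. Qed.

Lemma meanD f g : bounded_measurable f -> bounded_measurable g ->
  mean m (fun x => f x + g x) = mean m f + mean m g.
Proof. by move=> bf bg; rewrite RintegralD//; exact: itg. Qed.

Lemma meanB f g : bounded_measurable f -> bounded_measurable g ->
  mean m (fun x => f x - g x) = mean m f - mean m g.
Proof. by move=> bf bg; rewrite RintegralB//; exact: itg. Qed.

Lemma meanZ (c : R) f : bounded_measurable f ->
  mean m (fun x => c * f x) = c * mean m f.
Proof. by move=> bf; rewrite RintegralZl//; exact: itg. Qed.

Lemma le_mean f g : bounded_measurable f -> bounded_measurable g ->
  (forall x, f x <= g x) -> mean m f <= mean m g.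
Proof. by move=> bf bg fg; apply: le_Rintegral => //; exact: itg. Qed.

Lemma mean_ge0 f : (forall x, 0 <= f x) -> 0 <= mean m f.
Proof. by move=> f0; apply: Rintegral_ge0. Qed.

Lemma normr_mean_le f (M : R) : bounded_measurable f ->
  (forall x, `|f x| <= M) -> `|mean m f| <= M.
Proof.
move=> bf fM; have bM := bounded_measurable_cst T M.
have fNM x : - M <= f x <= M by rewrite -ler_norml.
rewrite ler_norml; apply/andP; split.
  rewrite -(mean_cst (- M)); apply: le_mean => //.
    exact: bounded_measurable_cst.
  by move=> x; case/andP: (fNM x).
by rewrite -(mean_cst M); apply: le_mean => // x; case/andP: (fNM x).
Qed.

Lemma mean_indic (A : set T) : measurable A -> mean m \1_A = fine (m A).
Proof. by move=> mA; rewrite /Rintegral integral_indic// setIT. Qed.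

Lemma fin_num_mass1 (A : set T) : measurable A -> m A \is a fin_num.
Proof.
move=> mA; rewrite ge0_fin_numE//.
have : (m A <= m setT)%E by apply: le_measure => //; rewrite inE.
by move=> /le_lt_trans; apply; rewrite m1 ltry.
Qed.

End mean.

(** * Integration against probability kernels, and Fubini's theorem *)

Section mean_kernel.
Context d d' (X : measurableType d) (Y : measurableType d') (R : realType).
Variable k : X -> {measure set Y -> \bar R}.
Hypothesis k1 : forall x, k x setT = 1%E.
Hypothesis mk : forall A, measurable A -> measurable_fun setT (k ^~ A).

(** The kernel is a bare family of measures, so that the parameter can be time, space, or the pair
    of both. *)
Lemma bounded_measurable_kernel (g : Y -> R) : bounded_measurable g ->
  bounded_measurable (fun x => mean (k x) g).
Proof.
move=> bg; have [mg [M gM]] := bg; split; last first.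
  by exists M => x; exact: normr_mean_le.
have bM := bounded_measurable_cst Y M.
(* Raising [g] by its bound [M] makes the integrand nonnegative, as the measurability of kernel
   integrals demands. *)
have -> : (fun x => mean (k x) g) =
    (fun x => mean (k x) (fun y => g y + M) - M).
  by apply/funext => x; rewrite meanD// mean_cst// addrK.
apply: measurable_funB => //; apply: measurableT_comp => //.
apply: measurable_fun_integral_kernel => //.
  move=> z; rewrite lee_fin; have := gM z.
  by rewrite ler_norml => /andP[]; lra.
apply/measurable_EFinP; exact: measurable_funD.
Qed.

End mean_kernel.

Lemma mean_fubini d1 d2 (T1 : measurableType d1) (T2 : measurableType d2)
    (R : realType) (m1 : probability T1 R) (m2 : probability T2 R)
    (f : T1 * T2 -> R) : bounded_measurable f ->
  [/\ bounded_measurable (fun x => mean m2 (fun y => f (x, y))),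
      bounded_measurable (fun y => mean m1 (fun x => f (x, y))) &
      mean m1 (fun x => mean m2 (fun y => f (x, y))) =
      mean m2 (fun y => mean m1 (fun x => f (x, y)))].
Proof.
move=> bf; have [mf [M fM]] := bf.
have p1 : m1 setT = 1%E := probability_setT m1.
have p2 : m2 setT = 1%E := probability_setT m2.
have bf1 x : bounded_measurable (fun y => f (x, y)).
  by split; [exact: measurableT_comp|exists M].
have bf2 y : bounded_measurable (fun x => f (x, y)).
  by split; [exact: measurableT_comp|exists M].
(* Tonelli's theorem is applied to the nonnegative function [f + M]; the constant is cancelled at
   the end. *)
pose h z := (f z + M)%:E.
have mh : measurable_fun setT h by apply/measurable_EFinP; exact: measurable_funD.
have h0 z : (0 <= h z)%E.
  by rewrite lee_fin; have := fM z; rewrite ler_norml => /andP[]; lra.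
have hE1 x : (\int[m2]_y h (x, y))%E = (mean m2 (fun y => f (x, y)) + M)%:E.
  rewrite -[in RHS](mean_cst p2 M) -meanD//; last exact: bounded_measurable_cst.
  rewrite /Rintegral fineK//; apply: integrable_fin_num => //.
  apply: bounded_measurable_integrable => //.
  by apply: bounded_measurableD => //; exact: bounded_measurable_cst.
have hE2 y : (\int[m1]_x h (x, y))%E = (mean m1 (fun x => f (x, y)) + M)%:E.
  rewrite -[in RHS](mean_cst p1 M) -meanD//; last exact: bounded_measurable_cst.
  rewrite /Rintegral fineK//; apply: integrable_fin_num => //.
  apply: bounded_measurable_integrable => //.
  by apply: bounded_measurableD => //; exact: bounded_measurable_cst.
have b1 : bounded_measurable (fun x => mean m2 (fun y => f (x, y))).
  split; last by exists M => x; exact: normr_mean_le.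
  have := @measurable_fun_fubini_tonelli_F _ _ _ _ _ m2 h mh h0.
  rewrite /fubini_F; under eq_fun do rewrite hE1.
  move/measurable_EFinP => mF.
  have -> : (fun x => mean m2 (fun y => f (x, y))) =
      (fun x => (mean m2 (fun y => f (x, y)) + M) - M).
    by apply/funext => x; rewrite addrK.
  exact: measurable_funB.
have b2 : bounded_measurable (fun y => mean m1 (fun x => f (x, y))).
  split; last by exists M => x; exact: normr_mean_le.
  have := @measurable_fun_fubini_tonelli_G _ _ _ _ _ m1 h mh h0.
  rewrite /fubini_G; under eq_fun do rewrite hE2.
  move/measurable_EFinP => mF.
  have -> : (fun y => mean m1 (fun x => f (x, y))) =
      (fun x => (mean m1 (fun y => f (y, x)) + M) - M).
    by apply/funext => x; rewrite addrK.
  exact: measurable_funB.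
split => //; apply: (addIr M).
rewrite -[X in _ + X = _](mean_cst p1 M) -[X in _ = _ + X](mean_cst p2 M).
rewrite -!meanD//; do ?exact: bounded_measurable_cst.
rewrite /Rintegral; congr fine.
rewrite -(eq_integral _ _ (fun x _ => hE1 x)) -(eq_integral _ _ (fun y _ => hE2 y)).
exact: (@fubini_tonelli _ _ _ _ _ m1 m2 h).
Qed.

(** * Positive unital functionals *)

(** This amounts to integration against a finitely additive probability. Countable additivity is
    left out so that the class is closed under ultralimits. *)
Definition state d (T : measurableType d) (R : realType)
    (L : (T -> R) -> R) : Prop :=
  [/\ forall f g, bounded_measurable f -> bounded_measurable g ->
        L (fun x => f x + g x) = L f + L g,
      forall c f, bounded_measurable f -> L (fun x => c * f x) = c * L f,
      forall f, bounded_measurable f -> (forall x, 0 <= f x) -> 0 <= L f &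
      L (fun=> 1) = 1].

Lemma mean_state d (T : measurableType d) (R : realType)
    (m : {measure set T -> \bar R}) : m setT = 1%E -> state (fun f => mean m f).
Proof.
move=> m1; split.
- by move=> f g; exact: meanD.
- by move=> c f; exact: meanZ.
- by move=> f _; exact: mean_ge0.
- by rewrite mean_cst.
Qed.

Section state.
Context d (T : measurableType d) (R : realType).
Implicit Types (f g : T -> R) (L : (T -> R) -> R).

Lemma stateB L f g : state L -> bounded_measurable f -> bounded_measurable g ->
  L (fun x => f x - g x) = L f - L g.
Proof.
move=> [LD LZ _ _] bf bg.
have -> : (fun x => f x - g x) = (fun x => f x + (-1) * g x).
  by apply/funext => x; rewrite mulN1r.
by rewrite LD ?LZ ?mulN1r//; exact: bounded_measurableZ.
Qed.

Lemma state_cst L (c : R) : state L -> L (fun=> c) = c.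
Proof.
move=> [_ LZ _ L1].
transitivity (c * L (fun=> 1)); last by rewrite L1 mulr1.
rewrite -LZ; last exact: bounded_measurable_cst.
by congr L; apply/funext => x; rewrite mulr1.
Qed.

Lemma le_state L f g : state L -> bounded_measurable f -> bounded_measurable g ->
  (forall x, f x <= g x) -> L f <= L g.
Proof.
move=> sL bf bg fg; rewrite -subr_ge0 -(stateB sL)//.
case: sL => _ _ + _; apply; first exact: bounded_measurableB.
by move=> x; rewrite subr_ge0.
Qed.

Lemma normr_state_le L f (M : R) : state L -> bounded_measurable f ->
  (forall x, `|f x| <= M) -> `|L f| <= M.
Proof.
move=> sL bf fM.
have fNM x : - M <= f x <= M by rewrite -ler_norml.
rewrite ler_norml -[in leLHS](state_cst (- M) sL) -[in X in _ && X](state_cst M sL).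
apply/andP; split; apply: le_state => //; try exact: bounded_measurable_cst.
  by move=> x; case/andP: (fNM x).
by move=> x; case/andP: (fNM x).
Qed.

Lemma state_sum L n (F : nat -> T -> R) : state L ->
  (forall i, bounded_measurable (F i)) ->
  L (fun x => \sum_(i < n) F i x) = \sum_(i < n) L (F i).
Proof.
move=> sL bF; elim: n => [|n IH].
  by under eq_fun do rewrite big_ord0; rewrite state_cst// big_ord0.
rewrite big_ord_recr/= -IH; case: sL => + _ _ _ => <- //.
  by congr L; apply/funext => x; rewrite big_ord_recr.
exact: bounded_measurable_sum.
Qed.

(** The sum counts the integers from 1 to [n] that do not exceed [x], so it is the integer part of
    [x]. *)
Lemma sum_thresholds (n : nat) (x : R) : 0 <= x <= n%:R ->
  `|x - \sum_(i < n) (i.+1%:R <= x)%R%:R| <= 1.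
Proof.
have full k (y : R) : k%:R <= y -> \sum_(i < k) (i.+1%:R <= y)%R%:R = k%:R :> R.
  move=> ky; rewrite (eq_bigr (fun=> 1))//; last first.
    by move=> i _; rewrite (le_trans _ ky)// ler_nat.
  by rewrite big_const_ord iter_addr_0.
have le k (y : R) : 0 <= y -> \sum_(i < k) (i.+1%:R <= y)%R%:R <= y.
  move=> y0; elim: k => [|k IH]; first by rewrite big_ord0.
  rewrite big_ord_recr/=; have [ky|_] := boolP (k.+1%:R <= y); last by rewrite addr0.
  rewrite full ?mulr1n ?natr1//.
  by rewrite (le_trans _ ky)// ler_nat.
have ge k (y : R) : y <= k%:R -> y - 1 <= \sum_(i < k) (i.+1%:R <= y)%R%:R.
  elim: k => [|k IH] yk; first by rewrite big_ord0; lra.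
  rewrite big_ord_recr/=; case: (leP k%:R y) => ky.
    rewrite full//; move: yk; rewrite -natr1 => yk.
    by case: (_ <= y); rewrite /=; lra.
  rewrite (le_trans (IH (ltW ky)))// lerDl.
  by case: (_ <= y).
move=> /andP[x0 xn]; have := le n x x0; have := ge n x xn.
by rewrite ler_norml => ? ?; apply/andP; split; lra.
Qed.

(** The magnified function [k * (f + M)] is within 1 of a finite sum of indicators of its superlevel
    sets, on which both states agree. Hence [k * |L1 f - L2 f| <= 2] for every [k]. *)
Lemma state_ext L1 L2 : state L1 -> state L2 ->
  (forall A, measurable A -> L1 \1_A = L2 \1_A) ->
  forall f, bounded_measurable f -> L1 f = L2 f.
Proof.
move=> s1 s2 L12 f bf; have [mf [M fM]] := bf.
have near k : k%:R * `|L1 f - L2 f| <= 2.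
  pose h x := k%:R * (f x + M).
  have bfM : bounded_measurable (fun x => f x + M).
    by apply: bounded_measurableD => //; exact: bounded_measurable_cst.
  have bh : bounded_measurable h by exact: bounded_measurableZ.
  have h0 x : 0 <= h x.
    by rewrite mulr_ge0//; have := fM x; rewrite ler_norml => /andP[]; lra.
  have [_ [N hN]] := bh.
  pose n := (Num.truncn N).+1.
  have hn x : h x <= n%:R.
    by rewrite (le_trans (ler_norm _))// (le_trans (hN x))// ltW// truncnS_gt.
  pose A i := [set x | i.+1%:R <= h x].
  have mA i : measurable (A i).
    rewrite -[A i]setTI; apply: measurable_fun_le => //; by case: bh.
  pose S x : R := \sum_(i < n) \1_(A i) x.
  have bS : bounded_measurable S.
    by apply: (@bounded_measurable_sum _ _ _ n (fun i => \1_(A i))) => i;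
      exact: bounded_measurable_indic.
  have LS : L1 S = L2 S.
    rewrite (@state_sum _ n (fun i => \1_(A i)) s1); last first.
      by move=> i; exact: bounded_measurable_indic.
    rewrite (@state_sum _ n (fun i => \1_(A i)) s2); last first.
      by move=> i; exact: bounded_measurable_indic.
    by apply: eq_bigr => i _; exact: L12.
  have hS x : `|h x - S x| <= 1.
    rewrite (_ : S x = \sum_(i < n) (i.+1%:R <= h x)%R%:R).
      by apply: sum_thresholds; rewrite h0 hn.
    by apply: eq_bigr => i _; rewrite indicE; congr (_%:R); rewrite /A mem_setE.
  have bhS := bounded_measurableB bh bS.
  have d1 := normr_state_le s1 bhS hS; have d2 := normr_state_le s2 bhS hS.
  have hL L : state L -> L h = k%:R * (L f + M).
    move=> sL; have [LD LZ _ _] := sL.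
    by rewrite LZ// LD ?state_cst//; exact: bounded_measurable_cst.
  move: d1 d2; rewrite !stateB// !hL// LS !ler_norml => /andP[? ?] /andP[? ?].
  rewrite -[X in X * _]ger0_norm// -normrM ler_norml; apply/andP; split; lra.
apply/eqP; rewrite -subr_eq0 -normr_eq0; apply/eqP/le_anti/andP; split => //.
rewrite leNgt; apply/negP => e0.
pose k := (Num.truncn (2 / `|L1 f - L2 f|)).+1.
have : 2 / `|L1 f - L2 f| < k%:R by exact: truncnS_gt.
by rewrite ltr_pdivrMr// ltNge near.
Qed.

End state.

Lemma sum_indic_trivIset_le (T : Type) (R : realType) (F : nat -> set T) n x :
  trivIset setT F -> \sum_(i < n) \1_(F i) x <= \1_(\bigcup_i F i) x :> R.
Proof.
move=> tF; have [[i _ Fix]|nF] := pselect ((\bigcup_i F i) x); last first.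
  rewrite big1 ?indicE// => i _; rewrite indicE memNset//.
  by move=> Fix; apply: nF; exists i.
rewrite [leRHS]indicE mem_set/=; last by exists i.
have F0 j : j != i -> \1_(F j) x = 0 :> R.
  move=> ji; rewrite indicE memNset// => Fjx; move/eqP: ji; apply.
  by apply: tF => //; exists x.
have [ni|ni] := leqP n i.
  rewrite big1// => j _; rewrite F0//.
  by rewrite neq_ltn (leq_trans (ltn_ord j) ni).
rewrite (bigD1 (Ordinal ni))//= big1 ?addr0.
  by rewrite indicE; case: (_ \in _).
by move=> j ji; apply: F0; apply: contra ji => /eqP ji; apply/eqP/val_inj.
Qed.

(** Domination by [C * mu] carries countable additivity over from [mu]: for disjoint sets, [L] of
    the union's indicator minus a partial sum lies between 0 and [C] times its [mu]-integral, which
    tends to 0. *)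
Lemma state_measure d (T : measurableType d) (R : realType)
    (mu : probability T R) (C : R) (L : (T -> R) -> R) : state L ->
  (forall f, bounded_measurable f -> (forall x, 0 <= f x) ->
     L f <= C * mean mu f) ->
  exists nu : probability T R, forall f, bounded_measurable f -> mean nu f = L f.
Proof.
move=> sL LC; have [LD LZ L0 L1] := sL.
have mu1 : mu setT = 1%E := probability_setT mu.
have Lge0 A : measurable A -> 0 <= L \1_A.
  by move=> mA; apply: L0 => //; exact: bounded_measurable_indic.
(* The absolute value makes [m] nonnegative on non-measurable sets too, where a state is
   unconstrained; on measurable sets it changes nothing. *)
pose m (A : set T) : \bar R := `|L \1_A|%:E.
have m0 : m set0 = 0%E.
  rewrite /m (_ : \1_set0 = fun=> 0); first by rewrite state_cst// normr0.
  by apply/funext => x; rewrite indicE in_set0.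
have m_ge0 A : (0 <= m A)%E by rewrite lee_fin.
have m_sigma : semi_sigma_additive m.
  move=> F mF tF mUF.
  have bF i : bounded_measurable (\1_(F i) : T -> R).
    exact: bounded_measurable_indic.
  have bU := bounded_measurable_indic R mUF.
  pose S n x : R := \sum_(i < n) \1_(F i) x.
  have bS n : bounded_measurable (S n).
    exact: (@bounded_measurable_sum _ _ _ n (fun i => \1_(F i))).
  have muS : mean mu (S n) @[n --> \oo] --> mean mu \1_(\bigcup_i F i).
    suff : (mean mu (S n))%:E @[n --> \oo] --> (mean mu \1_(\bigcup_i F i))%:E.
      by move/fine_cvg.
    rewrite mean_indic// fineK; last exact: fin_num_mass1.
    apply: cvg_trans (@measure_semi_sigma_additive _ _ _ mu F mF tF mUF).
    apply: near_eq_cvg; near=> n.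
    rewrite (state_sum n (mean_state mu1) bF) big_mkord -sumEFin.
    apply: eq_bigr => i _; rewrite mean_indic// fineK//.
    exact: fin_num_mass1.
  have -> : (fun n => \sum_(0 <= i < n) m (F i))%E = (fun n => (L (S n))%:E).
    apply/funext => n; rewrite big_mkord sumEFin (state_sum n sL bF).
    by congr EFin; apply: eq_bigr => i _; rewrite ger0_norm// Lge0.
  rewrite /m ger0_norm ?Lge0//; apply: cvg_EFin; first by near=> n.
  apply/subr_cvg0.
  apply: (@squeeze_cvgr _ _ _ _
    (fun n => C * (mean mu (S n) - mean mu \1_(\bigcup_i F i))) (fun=> 0)).
  - near=> n => /=; have SU x : S n x <= \1_(\bigcup_i F i) x.
      exact: sum_indic_trivIset_le.
    rewrite subr_le0 (le_state sL)// andbT.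
    have := LC _ (bounded_measurableB bU (bS n)).
    rewrite stateB// meanB// => /(_ (fun x => ltac:(by rewrite subr_ge0))); lra.
  - rewrite -[X in _ --> X](mulr0 C); apply: cvgM; first exact: cvg_cst.
    by move/subr_cvg0: muS; apply.
  - exact: cvg_cst.
pose mm := HB.pack_for {measure set T -> \bar R} m
  (isMeasure.Build _ _ _ m m0 m_ge0 m_sigma).
have mm1 : mm setT = 1%E.
  by rewrite /= /m indicT L1 normr1.
pose nu := HB.pack_for (probability T R) m
  (isMeasure.Build _ _ _ m m0 m_ge0 m_sigma)
  (Measure_isProbability.Build _ _ _ mm mm1).
exists nu; have nu1 : nu setT = 1%E := probability_setT nu.
apply: (state_ext (mean_state nu1) sL) => A mA.
by rewrite mean_indic//= /m ger0_norm// Lge0.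
Unshelve. all: by end_near.
Qed.

(** * Limits along ultrafilters *)

Section ultralimit.
Context (T : Type) (R : realType).

Lemma bounded_ultra_cvg (U : set_system T) (a : T -> R) (M : R) :
  UltraFilter U -> (\forall t \near U, `|a t| <= M) -> cvg (a @ U).
Proof.
move=> UU aM; have := @segment_compact R (- M) M.
rewrite compact_ultra => /(_ (a @ U)) [].
(* The image of [U] is again maximal: [U] contains either the preimage of [B] or its complement, and
   the latter would put two disjoint sets in [G]. *)
- split; first exact: fmap_proper_filter.
  move=> G PG aG; apply/seteqP; split => // B GB.
  have [//|nB] := in_ultra_setVsetC (a @^-1` B) UU.
  have /aG GnB : (a @ U) (~` B) by exact: nB.
  have : G (B `&` ~` B) by exact: filterI.
  by rewrite setICr => /filter_not_empty.
- suff : U (a @^-1` `[- M, M]%classic) by [].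
  by apply: filterS aM => t; rewrite /= in_itv/= -ler_norml.
- by move=> l [_ al]; apply/cvg_ex; exists l.
Qed.

(** If convergence fails for some [e], then [F] restricted to the points where [a] is at least [e]
    away from [l] is still proper, and an ultrafilter refining it contradicts the hypothesis. *)
Lemma cvg_ultra (F : set_system T) (a : T -> R) (l : R) : ProperFilter F ->
  (forall U : set_system T, UltraFilter U -> F `<=` U -> a t @[t --> U] --> l) ->
  a t @[t --> F] --> l.
Proof.
move=> FF aU; apply/cvgrPdist_lt => e e0; apply: contrapT => nF.
pose S := [set t | `|l - a t| < e].
have WF : ProperFilter (within (~` S) F).
  apply: Build_ProperFilter_ex => B WB; apply: contrapT => nB; apply: nF.
  suff WS : [set t | (~` S) t -> B t] `<=` S by exact: filterS WS WB.
  move=> t tB; apply: contrapT => nS.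
  by apply: nB; exists t; exact: tB.
have [U [UU WU]] := ultraFilterLemma WF.
have FU : F `<=` U.
  move=> B FB; apply: WU.
  suff BW : B `<=` [set t | (~` S) t -> B t] by exact: filterS BW FB.
  by move=> t Bt _.
have /cvgrPdist_lt/(_ e e0) US := aU U UU FU.
have UnS : U (~` S).
  apply: WU; suff SS : setT `<=` [set t | (~` S) t -> (~` S) t].
    exact: filterS SS filterT.
  by move=> t _ nSt.
have : U (S `&` ~` S) by exact: filterI.
by rewrite setICr => /filter_not_empty.
Qed.

End ultralimit.

(** * Lipschitz approximation on Polish spaces *)

Lemma bounded_measurable_cvg d (T : measurableType d) (R : realType)
    (F : nat -> T -> R) (f : T -> R) (M : R) :
  (forall n, measurable_fun setT (F n)) -> (forall n x, `|F n x| <= M) ->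
  (forall x, F n x @[n --> \oo] --> f x) -> bounded_measurable f.
Proof.
move=> mF FM Ff; split; first by apply: (measurable_fun_cvg mF) => x _; exact: Ff.
exists M => x.
have nFf : `|F n x| @[n --> \oo] --> `|f x| by apply: cvg_norm; exact: Ff.
rewrite -(cvg_lim _ nFf)//; apply: limr_le; first by apply/cvg_ex; exists `|f x|.
by near=> n; exact: FM.
Unshelve. all: by end_near.
Qed.

Lemma mean_cvg d (T : measurableType d) (R : realType)
    (m : {measure set T -> \bar R}) (F : nat -> T -> R) (f : T -> R) (M : R) :
  m setT = 1%E ->
  (forall n, measurable_fun setT (F n)) -> (forall n x, `|F n x| <= M) ->
  (forall x, F n x @[n --> \oo] --> f x) ->
  mean m (F n) @[n --> \oo] --> mean m f.
Proof.
move=> m1 mF FM Ff; have bf := bounded_measurable_cvg mF FM Ff.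
apply: fine_cvg; rewrite fineK; last first.
  by apply: integrable_fin_num => //; exact: bounded_measurable_integrable.
apply: (@dominated_cvg _ _ _ m setT measurableT _ _ (EFin \o cst M)).
- by move=> n; exact/measurable_EFinP.
- by move=> x _; apply: cvg_EFin; [near=> n|exact: Ff].
- by [].
- by apply: (@bounded_measurable_integrable _ _ _ _ m1 (cst M)); exact: bounded_measurable_cst.
- by move=> n x _ /=; rewrite lee_fin.
Unshelve. all: by end_near.
Qed.

(** The inf-convolution of [f] with [k * rho] is [k]-Lipschitz. For convergence at [x], lower
    semicontinuity bounds the contribution of points within [r] of [x], and beyond [r] the penalty
    [k * r] exceeds [M] once [k] is large. *)
Lemma lipschitz_approx (R : realType) (X : Type) (rho : X -> X -> R)
    (f : X -> R) (M : R) :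
  (forall x y, 0 <= rho x y) -> (forall x, rho x x = 0) ->
  (forall x y, rho x y = rho y x) ->
  (forall x y z, rho x z <= rho x y + rho y z) ->
  (forall x, 0 <= f x <= M) ->
  (forall x e, 0 < e -> exists2 r, 0 < r &
     forall y, rho x y < r -> f x - e < f y) ->
  exists F : nat -> X -> R, [/\ forall k, bounded_lipschitz rho (F k),
    forall k x, 0 <= F k x <= f x &
    forall x, F k x @[k --> \oo] --> f x].
Proof.
move=> rho0 rhoxx rhoC rhoD fM lsc.
pose E k x := [set f y + k%:R * rho x y | y in [set: X]].
have E0 k x : lbound (E k x) 0.
  by move=> _ [y _ <-]; rewrite addr_ge0 ?mulr_ge0//; case/andP: (fM y).
have Ele k x y : inf (E k x) <= f y + k%:R * rho x y.
  by apply: ge_inf; [exists 0; exact: E0|exists y].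
have leE k x c : (forall y, c <= f y + k%:R * rho x y) -> c <= inf (E k x).
  move=> h; apply: lb_le_inf; first by exists (f x + k%:R * rho x x), x.
  by move=> _ [y _ <-].
have Ef k x : 0 <= inf (E k x) <= f x.
  rewrite leE//=; first by have := Ele k x x; rewrite rhoxx mulr0 addr0.
  by move=> y; apply: E0; exists y.
exists (fun k x => inf (E k x)); split => //.
- move=> k; split.
    exists M => x; have /andP[h0 h1] := Ef k x.
    by rewrite ger0_norm// (le_trans h1)//; case/andP: (fM x).
  exists k%:R => x y.
  have half u v : inf (E k u) - k%:R * rho u v <= inf (E k v).
    apply: leE => w; have := Ele k u w; have := rhoD u v w.
    move=> /(ler_wpM2l (ler0n R k)); lra.
  have := half x y; have := half y x; rewrite (rhoC y x) ler_norml => ? ?.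
  by apply/andP; split; lra.
- move=> x; apply/cvgrPdist_le => e e0.
  have [r r0 hr] := lsc x e e0.
  near=> k; have /andP[_ h1] := Ef k x.
  rewrite ger0_norm ?subr_ge0// lerBlDr -lerBlDl.
  apply: leE => y; have /andP[fy0 _] := fM y.
  have [ry|ry] := ltP (rho x y) r.
    have := hr _ ry; have : 0 <= k%:R * rho x y by rewrite mulr_ge0.
    lra.
  have kr : M <= k%:R * r.
    by rewrite -ler_pdivrMr//; near: k; exact: nbhs_infty_ger.
  have : k%:R * r <= k%:R * rho x y by rewrite ler_wpM2l.
  by have /andP[_] := fM x; lra.
Unshelve. all: by end_near.
Qed.

Section polish.
Context (R : realType) (X : completePseudoMetricType R) (rho : X -> X -> R).
Hypothesis pm : polish_metric rho.

Lemma polish_nbhsP (x : X) (A : set X) :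
  nbhs x A <-> exists2 r, 0 < r & forall y, rho x y < r -> A y.
Proof.
have [[_ _ _ _ ballE] _] := pm; split.
  move=> /nbhs_ballP[r r0 rA]; exists r => // y xy; apply: rA.
  by rewrite ballE.
move=> [r r0 rA]; apply/nbhs_ballP; exists r => // y.
by rewrite ballE; exact: rA.
Qed.

Lemma lipschitz_continuous (f : X -> R) :
  bounded_lipschitz rho f -> bounded_continuous f.
Proof.
move=> [fM [L fL]]; split => // x; apply/cvgrPdist_lt => e e0.
(* The constant [L] may be zero or negative, whereas [|L| + 1] is positive. *)
apply/polish_nbhsP; exists (e / (`|L| + 1)); first by rewrite divr_gt0// ltr_wpDl.
move=> y; rewrite ltr_pdivlMr; last by rewrite ltr_wpDl.
have [[rho0 _ _ _ _] _] := pm.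
move=> h; rewrite (le_lt_trans (fL x y))// (le_lt_trans _ h)//.
rewrite mulrC ler_wpM2l// (le_trans (ler_norm L))// lerDl.
exact: ler01.
Qed.

Lemma continuous_bounded_measurable (f : X -> R) :
  bounded_continuous f -> bounded_measurable (f : borel X -> R).
Proof.
move=> [/continuousP cf fM]; split => //.
apply: (measurability _ (RGenOpens.measurableE R)).
move=> _ [_ [a [b ->] <-]]; rewrite setTI.
apply: sub_sigma_algebra; apply: cf; exact: interval_open.
Qed.

Lemma lsc_lipschitz_approx (f : X -> R) (M : R) : (forall x, 0 <= f x <= M) ->
  (forall x e, 0 < e -> \forall y \near x, f x - e < f y) ->
  exists F : nat -> X -> R, [/\ forall k, bounded_lipschitz rho (F k),
    forall k x, 0 <= F k x <= f x &
    forall x, F k x @[k --> \oo] --> f x].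
Proof.
have [[rho0 rhoxx rhoC rhoD _] _] := pm.
move=> fM lsc; apply: (lipschitz_approx rho0 _ rhoC rhoD fM) => //.
  by move=> x; apply/rhoxx.
by move=> x e e0; apply/polish_nbhsP; exact: lsc.
Qed.

Lemma polish_dense_seq : exists u : nat -> X,
  forall (x : X) r, 0 < r -> exists i, rho x (u i) < r.
Proof.
have [[_ _ _ _ ballE] [D [/countable_injP[g ginj] dD]]] := pm.
(* [u] inverts the injection [g] on [D]; integers outside its range get the default [point], which
   does no harm to density. *)
pose u i := xget point [set y | D y /\ g y = i].
exists u => x r r0.
have : ball x r `&` D !=set0.
  have : (ball x r)^° `&` D !=set0.
    apply: dD; last exact: open_interior.
    by exists x; exact: nbhsx_ballx.
  by apply: subset_nonempty => y [/interior_subset].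
move=> [y [xy Dy]]; exists (g y).
have : [set z | D z /\ g z = g y] (u (g y)) by apply: xgetPex; exists y.
move=> [Du gu]; have -> : u (g y) = y by apply: ginj => //; exact: mem_set.
by move: xy; rewrite ballE.
Qed.

End polish.

(** * Joint measurability of the semigroup *)

Section joint_measurability.
Context (R : realType) (X : completePseudoMetricType R) (rho : X -> X -> R).
Context (P : R -> R.-pker (borel X) ~> (borel X)).
Hypotheses (pm : polish_metric rho) (mfP : markov_feller P).

Lemma semigroup_mass1 t x : P t x setT = 1%E.
Proof. exact: prob_kernel. Qed.

(** The semigroup is measurable in time on the half-line only; writing [|s|] extends it to a
    function measurable on the whole line and unchanged for [s >= 0]. *)
Lemma time_bounded_measurable (x : borel X) (f : borel X -> R) :
  bounded_measurable f ->
  bounded_measurable (fun s : measurableTypeR R => mean (P `|s| x) f).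
Proof.
have [_ _ _ mP] := mfP.
apply: (@bounded_measurable_kernel _ _ (measurableTypeR R) (borel X) R
  (fun s => P `|s| x)).
  by move=> s; exact: semigroup_mass1.
move=> A mA.
apply: (@measurable_comp _ _ _ (measurableTypeR R) (measurableTypeR R) _
  `[0, +oo[%classic (fun s => P s x A) setT (fun s => `|s|)) => //.
- by move=> _ [s _ <-] /=; rewrite in_itv/= andbT.
- exact: mP.
- exact: normr_measurable.
Qed.

Lemma open_rho_ball (a : X) (r : R) : open [set y | rho y a < r].
Proof.
have [[_ _ rhoC rhoD _] _] := pm.
rewrite openE => y /= ya; apply/(polish_nbhsP pm).
exists (r - rho y a); first by rewrite subr_gt0.
move=> z yz /=; have := rhoD z y a; rewrite (rhoC z y); lra.
Qed.

(* A Caratheodory function (measurable in time, continuous in space) is a limit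
   of functions that replace the space variable by the first sufficiently close
   point of a dense sequence. *)
Lemma continuous_joint_measurable (f : X -> R) : bounded_continuous f ->
  measurable_fun setT
    (fun p : measurableTypeR R * borel X => mean (P `|p.1| p.2) f).
Proof.
move=> cf; have [_ _ feller _] := mfP.
have [u uX] := polish_dense_seq pm.
have exu k y : exists i, rho y (u i) < k.+1%:R^-1 by apply: uX; rewrite invr_gt0.
(* Taking the least index makes each level set of [first k] a ball minus finitely many earlier
   balls, hence measurable. *)
pose first k y := ex_minn (exu k y).
have firstP k y : rho y (u (first k y)) < k.+1%:R^-1.
  by rewrite /first; case: ex_minnP.
have mfirst k i : measurable ([set y | first k y = i] : set (borel X)).
  have -> : [set y | first k y = i] = [set y | rho y (u i) < k.+1%:R^-1] `\`
      \bigcup_(j in `I_i) [set y | rho y (u j) < k.+1%:R^-1].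
    apply/seteqP; split => y /=; rewrite /first; case: ex_minnP => m ym mP.
      move=> <-; split => // -[j /= jm yj].
      by have := mP _ yj; rewrite leqNgt jm.
    move=> [yi ni]; apply/eqP; rewrite eqn_leq mP//= leqNgt.
    by apply/negP => mi; apply: ni; exists m.
  apply: measurableD; first by apply: sub_sigma_algebra; exact: open_rho_ball.
  apply: bigcup_measurable => j _; apply: sub_sigma_algebra.
  exact: open_rho_ball.
pose F k (p : measurableTypeR R * borel X) :=
  mean (P `|p.1| (u (first k p.2))) f.
apply: (@measurable_fun_cvg _ _ _ _ F) => [k|p _].
  (* On each of the countably many strips where [first k] is constant, [F k] depends on time
     alone. *)
  have -> : [set: measurableTypeR R * borel X] =
      \bigcup_i (setT `*` [set y | first k y = i]).
    by apply/seteqP; split => // -[s y] _; exists (first k y).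
  apply/measurable_fun_bigcup => [i|i]; first exact: measurableX.
  pose G (s : measurableTypeR R) : R := mean (P `|s| (u i)) f.
  apply: (@eq_measurable_fun _ _ (measurableTypeR R * borel X)%type R _
    (G \o fst)).
    by move=> [s y] /[!inE] -[_ /= yi]; rewrite /F /G/= yi.
  apply: measurable_funTS; apply: measurableT_comp => //.
  by have [] := time_bounded_measurable (u i) (continuous_bounded_measurable cf).
have cP := feller `|p.1| (normr_ge0 _) f cf.
suff uy : u (first k p.2) @[k --> \oo] --> (p.2 : X) by exact: cvg_comp uy (cP _).
move=> A /(polish_nbhsP pm)[r r0 rA].
suff : \forall k \near \oo, rho p.2 (u (first k p.2)) < r.
  by apply: filterS => k; exact: rA.
near=> k.
rewrite (lt_trans (firstP k p.2))//.
rewrite invf_plt ?posrE//; apply: (@lt_trans _ _ k%:R); last by rewrite ltr_nat.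
by near: k; exact: nbhs_infty_gtr.
Unshelve. all: by end_near.
Qed.

(** The indicator of an open set is lower semicontinuous, hence a pointwise limit of Lipschitz
    functions with values in [[0, 1]]; dominated convergence passes this to the kernel integrals. *)
Lemma open_joint_measurable (U : set X) : open U ->
  measurable_fun setT
    (fun p : measurableTypeR R * borel X => P `|p.1| p.2 U).
Proof.
move=> oU.
have [] := @lsc_lipschitz_approx _ _ _ pm (\1_U : X -> R) 1.
- by move=> x; rewrite indicE; case: (_ \in _); rewrite ?lexx ?ler01.
- move=> x e e0; have [xU|xU] := boolP (x \in U).
    have : nbhs x U by apply: open_nbhs_nbhs; split => //; exact: set_mem.
    by apply: filterS => y Uy; rewrite !indicE xU mem_set//; lra.
  near=> y; rewrite !indicE (negbTE xU).
  by case: (_ \in _); rewrite /=; lra.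
move=> F [lF F01 FU].
have mU : measurable (U : set (borel X)) by exact: sub_sigma_algebra.
have bF k := continuous_bounded_measurable (lipschitz_continuous pm (lF k)).
have -> : (fun p : measurableTypeR R * borel X => P `|p.1| p.2 U) =
    (fun p => (mean (P `|p.1| p.2) (\1_U : borel X -> R))%:E).
  apply/funext => p; rewrite mean_indic// fineK//; apply: fin_num_mass1 => //.
  exact: semigroup_mass1.
apply/measurable_EFinP.
apply: (@measurable_fun_cvg _ _ _ _
  (fun k (p : measurableTypeR R * borel X) => mean (P `|p.1| p.2) (F k))) => [k|p _].
  apply: continuous_joint_measurable; exact: (lipschitz_continuous pm (lF k)).
apply: (@mean_cvg _ _ _ _ _ _ 1) => //.
- exact: semigroup_mass1.
- by move=> k; case: (bF k).
- move=> k x; have /andP[F0 F1] := F01 k x.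
  by rewrite ger0_norm// (le_trans F1).
Unshelve. all: by end_near.
Qed.

(** Open sets form a pi-system generating the Borel sets, and the property is stable under
    complements and countable disjoint unions. *)
Lemma set_joint_measurable (A : set (borel X)) : measurable A ->
  measurable_fun setT
    (fun p : measurableTypeR R * borel X => P `|p.1| p.2 A).
Proof.
pose mK (B : set (borel X)) := measurable_fun setT
  (fun p : measurableTypeR R * borel X => P `|p.1| p.2 B).
apply: (@dynkin_induction _ (borel X) (@open X) mK) => //.
- by move=> B C oB oC; exact: openI.
- apply: (eq_measurable_fun (fun=> 1%E)) => //.
  by move=> p _; rewrite semigroup_mass1.
- by move=> B; exact: open_joint_measurable.
- move=> B mB KB.
  apply: (eq_measurable_fun (fun p : measurableTypeR R * borel X =>
    1 - P `|p.1| p.2 B)%E).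
    move=> p _; rewrite -(semigroup_mass1 `|p.1| p.2) -setTD measureD//.
      by rewrite setTI.
    by rewrite -ge0_fin_numE//; apply: fin_num_mass1 => //; exact: semigroup_mass1.
  by apply: emeasurable_funB => //; exact: measurable_cst.
- move=> F mF tF KF.
  apply: (@emeasurable_fun_cvg _ _ _ _ (fun n (p : measurableTypeR R * borel X) =>
    \sum_(0 <= i < n) P `|p.1| p.2 (F i))%E).
    by move=> n; apply: emeasurable_sum => i; exact: KF.
  move=> p _; apply: measure_semi_sigma_additive => //.
  exact: bigcup_measurable.
Qed.

Lemma joint_bounded_measurable (f : borel X -> R) : bounded_measurable f ->
  bounded_measurable
    (fun p : measurableTypeR R * borel X => mean (P `|p.1| p.2) f).
Proof.
apply: (@bounded_measurable_kernel _ _ (measurableTypeR R * borel X)%type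
  (borel X) R (fun p => P `|p.1| p.2)).
  by move=> p; exact: semigroup_mass1.
exact: set_joint_measurable.
Qed.

Lemma space_bounded_measurable t (f : borel X -> R) : bounded_measurable f ->
  bounded_measurable (fun x : borel X => mean (P t x) f).
Proof.
apply: (@bounded_measurable_kernel _ _ (borel X) (borel X) R (P t)).
  by move=> x; exact: semigroup_mass1.
by move=> A mA; exact: measurable_kernel.
Qed.

End joint_measurability.

(** * Time averages *)

Section time_average.
Context (R : realType).
Local Notation leb := (@lebesgue_measure R).

Lemma bounded_measurable_integrable_itv (h : measurableTypeR R -> R) (i : interval R) :
  bounded_measurable h -> (leb [set` i] < +oo)%E ->
  leb.-integrable [set` i] (EFin \o h).
Proof.
move=> [mh [M hM]] ifin; apply: measurable_bounded_integrable => //.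
  exact: measurable_funTS.
by exists M; split; [exact: num_real|move=> N MN x _ /=; rewrite (le_trans (hM x))// ltW].
Qed.

Lemma lebesgue_measure_itv_lty (a b : R) (x y : bool) :
  (leb [set` Interval (BSide x a) (BSide y b)] < +oo)%E.
Proof. by rewrite lebesgue_measure_itv/=; case: ifP => _; rewrite ltry. Qed.

Lemma Rintegral_itv_shift (h : measurableTypeR R -> R) (a b r : R) :
  bounded_measurable h ->
  \int[leb]_(s in `[a, b]) h (s + r) = \int[leb]_(s in `[a + r, b + r]) h s.
Proof.
move=> bh; have [mh _] := bh; rewrite /Rintegral; congr fine.
have mshift : measurable_fun [set: measurableTypeR R]
    (fun s : measurableTypeR R => s + r : measurableTypeR R).
  by apply: measurable_funD => //; exact: measurable_cst.
have pre : (fun s : measurableTypeR R => s + r) @^-1` `[a + r, b + r]%classic =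
    `[a, b]%classic.
  by apply/seteqP; split => s /=; rewrite !in_itv/= !lerD2r.
have := @integral_pushforward _ _ _ _ _ _ mshift leb `[a + r, b + r]%classic
  (EFin \o h).
rewrite pre => <- //.
(* The image of Lebesgue measure under the translation gives []c, d]] its length, so by uniqueness
   it is Lebesgue measure. *)
- apply: eq_measure_integral => A mA _; apply/esym.
  apply: lebesgue_measure_unique => //= _ [[c d] _ <-].
  rewrite /pushforward.
  have -> : (fun s : measurableTypeR R => s + r) @^-1` `]c, d]%classic =
      `]c - r, d - r]%classic.
    apply/seteqP; split => s /=; rewrite !in_itv/=; lra.
  rewrite !lebesgue_measure_itv/= !lte_fin ltrD2r; case: ifP => // _.
  by rewrite -!EFinD; congr EFin; ring.
- exact/measurable_EFinP.
- apply: (@bounded_measurable_integrable_itv (fun s => h (s + r))) => //.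
    exact: (bounded_measurable_comp mshift bh).
  exact: lebesgue_measure_itv_lty.
Qed.

Definition time_average (t : R) (h : R -> R) : R :=
  t^-1 * \int[leb]_(s in `[0, t]) h s.

Lemma eq_time_average (t : R) (h g : R -> R) :
  (forall s, 0 <= s -> h s = g s) -> time_average t h = time_average t g.
Proof.
move=> hg; congr (_ * _); apply: eq_Rintegral => s.
by rewrite inE/= in_itv/= => /andP[s0 _]; exact: hg.
Qed.

(** As integrals against a probability, time averages fall under the results on means, Fubini's
    theorem included. *)
Lemma time_average_uniform (t : R) (t0 : 0 < t) (h : measurableTypeR R -> R) :
  bounded_measurable h -> time_average t h = mean (uniform_prob t0) h.
Proof.
move=> bh; have [mh [M hM]] := bh.
have u1 : uniform_prob t0 setT = 1%E := probability_setT (uniform_prob t0).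
have bM : bounded_measurable (fun _ : measurableTypeR R => M).
  exact: bounded_measurable_cst.
have bhM := bounded_measurableD bh bM.
have : mean (uniform_prob t0) (fun s => h s + M) =
    t^-1 * \int[leb]_(s in `[0, t]) (h s + M).
  rewrite /Rintegral integral_uniform ?subr0.
  - rewrite -[in RHS](_ : fine t^-1%:E = t^-1)// -fineM//.
    apply: integrable_fin_num => //.
    apply: (bounded_measurable_integrable_itv bhM).
    exact: lebesgue_measure_itv_lty.
  - by apply/measurable_EFinP; case: bhM.
  - by move=> s; rewrite lee_fin; have := hM s; rewrite ler_norml => /andP[]; lra.
rewrite meanD// mean_cst// RintegralD//; last 2 first.
- by apply: bounded_measurable_integrable_itv => //; exact: lebesgue_measure_itv_lty.
- by apply: (bounded_measurable_integrable_itv bM); exact: lebesgue_measure_itv_lty.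
rewrite Rintegral_cst//= lebesgue_measure_itv/= lte_fin t0/= subr0.
by rewrite mulrDr (mulrCA _ M) mulVf ?gt_eqF// mulr1 => /addIr.
Qed.

(** The windows [[r, t + r]] and [[0, t]] differ by two intervals of length [r], and the integral
    over each is at most [M * r] in absolute value. *)
Lemma time_average_shift (t r M : R) (h : measurableTypeR R -> R) :
  bounded_measurable h -> (forall s, `|h s| <= M) -> 0 < t -> 0 <= r ->
  `|time_average t (fun s => h (s + r)) - time_average t h| <= t^-1 * (2 * (M * r)).
Proof.
move=> bh hM t0 r0.
have ih a b (x y : bool) :
    leb.-integrable [set` Interval (BSide x a) (BSide y b)] (EFin \o h).
  by apply: bounded_measurable_integrable_itv => //; exact: lebesgue_measure_itv_lty.
have small a b (x y : bool) : a <= b ->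
    `|\int[leb]_(s in [set` Interval (BSide x a) (BSide y b)]) h s| <= M * (b - a).
  move=> ab; apply: le_trans (le_normr_Rintegral _ (ih _ _ _ _)) _ => //.
  have -> : M * (b - a) =
      \int[leb]_(s in [set` Interval (BSide x a) (BSide y b)]) M.
    rewrite Rintegral_cst//= lebesgue_measure_itv/= lte_fin.
    have [//|ba] := ltP a b.
    by have -> : b - a = 0 by lra.
  apply: le_Rintegral => //.
  - by apply: (@bounded_measurable_integrable_itv (fun s => `|h s|));
      [exact: bounded_measurable_norm|exact: lebesgue_measure_itv_lty].
  - by apply: (@bounded_measurable_integrable_itv (fun=> M));
      [exact: bounded_measurable_cst|exact: lebesgue_measure_itv_lty].
rewrite /time_average (Rintegral_itv_shift _ _ _ bh) add0r -mulrBr normrM.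
have ti0 : 0 <= t^-1 by rewrite invr_ge0 ltW.
rewrite (ger0_norm ti0); apply: ler_wpM2l => //.
have split1 := @Rintegral_itvB _ h (BLeft 0) (BRight (t + r)) t (ih _ _ _ _).
have split2 := @Rintegral_itvB _ h (BLeft 0) (BRight (t + r)) r (ih _ _ _ _).
move: split1 split2; rewrite !bnd_simp => /(_ (ltW t0)) split1 /(_ r0) split2.
have {}split1 := split1 ltac:(by rewrite lerDl).
have {}split2 := split2 ltac:(by rewrite lerDr ltW).
(* Splitting at [r] leaves an interval open at [r]; a single point does not affect the integral. *)
rewrite -Rintegral_itv_obnd_cbnd// -split2.
have -> : forall A B C : R, A - B - C = (A - C) - B by move=> *; ring.
rewrite split1 (le_trans (ler_normB _ _))//.
have tr : t <= t + r by rewrite lerDl.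
rewrite (le_trans (lerD (small _ _ false false tr) (small _ _ true false r0)))//.
by rewrite subr0 (addrC t) addrK mulr2n mulrDl mul1r.
Qed.

End time_average.

(** * Averages, ultralimits and differences of states *)

Section state_constructions.
Context d (T : measurableType d) (R : realType).

Lemma state_mean d' (S : measurableType d') (m : {measure set S -> \bar R})
    (L : S -> (T -> R) -> R) : m setT = 1%E -> (forall s, state (L s)) ->
  (forall g, bounded_measurable g -> bounded_measurable (fun s => L s g)) ->
  state (fun g => mean m (fun s => L s g)).
Proof.
move=> m1 sL bL; split.
- move=> f g bf bg; rewrite -meanD//; [|exact: bL|exact: bL].
  by congr Rintegral; apply/funext => s; have [-> //] := sL s.
- move=> c f bf; rewrite -meanZ//; last exact: bL.
  by congr Rintegral; apply/funext => s; have [_ -> //] := sL s.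
- by move=> f bf f0; apply: mean_ge0 => s; have [_ _ + _] := sL s; exact.
- rewrite -[RHS](mean_cst m1); congr Rintegral; apply/funext => s.
  by have [_ _ _ ->] := sL s.
Qed.

Lemma state_weighted (m : {measure set T -> \bar R}) (phi : T -> R)
    d' (Y : measurableType d') (L : T -> (Y -> R) -> R) : m setT = 1%E ->
  bounded_measurable phi -> (forall x, 0 <= phi x) -> 0 < mean m phi ->
  (forall s, state (L s)) ->
  (forall g, bounded_measurable g -> bounded_measurable (fun s => L s g)) ->
  state (fun g => (mean m phi)^-1 * mean m (fun x => phi x * L x g)).
Proof.
move=> m1 bphi phi0 c0 sL bL.
have bpL g : bounded_measurable g -> bounded_measurable (fun x => phi x * L x g).
  by move=> bg; apply: bounded_measurableM => //; exact: bL.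
split.
- move=> f g bf bg; rewrite -mulrDr -meanD//; [|exact: bpL|exact: bpL].
  congr (_ * Rintegral _ _ _); apply/funext => s; have [-> //] := sL s.
  by rewrite mulrDr.
- move=> a f bf; rewrite mulrCA -(meanZ m1 a); last exact: bpL.
  congr (_ * Rintegral _ _ _); apply/funext => s; have [_ -> //] := sL s.
  by rewrite mulrCA.
- move=> f bf f0; rewrite mulr_ge0//; first by rewrite invr_ge0 ltW.
  apply: mean_ge0 => s.
  by rewrite mulr_ge0//; have [_ _ + _] := sL s; exact.
- rewrite -[RHS](mulVf (lt0r_neq0 c0)); congr (_ * Rintegral _ _ _).
  by apply/funext => s; have [_ _ _ ->] := sL s; rewrite mulr1.
Qed.

(** States preserve bounds, so the values on a fixed [g] stay in a compact interval and converge
    along [U]. The state property is asked only eventually, since time averages have it for positive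
    times. *)
Lemma state_ultralim (I : Type) (U : set_system I) (L : I -> (T -> R) -> R) :
  UltraFilter U -> (\forall i \near U, state (L i)) ->
  (forall g, bounded_measurable g -> cvg (L i g @[i --> U])) /\
  state (fun g => lim (L i g @[i --> U])).
Proof.
move=> UU sL.
have cL g : bounded_measurable g -> cvg (L i g @[i --> U]).
  move=> bg; have [mg [M gM]] := bg; apply: (@bounded_ultra_cvg I R U _ M) => //.
  by apply: filterS sL => i si; exact: normr_state_le.
split => //; split.
- move=> f g bf bg; apply: cvg_lim => //.
  apply: cvg_trans (cvgD (cL f bf) (cL g bg)); apply: near_eq_cvg.
  by apply: filterS sL => i [-> //].
- move=> c f bf; apply: cvg_lim => //.
  apply: cvg_trans (cvgM (cvg_cst c) (cL f bf)); apply: near_eq_cvg.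
  by apply: filterS sL => i [_ -> //].
- move=> f bf f0; apply: limr_ge; first exact: cL.
  by apply: filterS sL => i [_ _ + _]; exact.
- apply: cvg_lim => //; apply: (@cvg_trans _ ((fun _ : I => 1 : R) @ U));
    last exact: cvg_cst.
  apply: near_eq_cvg.
  by apply: filterS sL => i [_ _ _ ->].
Qed.

(** This is the other component when [L2] is split as a convex combination with weight [l] on
    [L1]. *)
Lemma state_complement (L1 L2 : (T -> R) -> R) (l : R) : 0 < l < 1 ->
  state L1 -> state L2 ->
  (forall f, bounded_measurable f -> (forall x, 0 <= f x) -> l * L1 f <= L2 f) ->
  state (fun f => (1 - l)^-1 * (L2 f - l * L1 f)).
Proof.
move=> /andP[l0 l1] [D1 Z1 _ U1] [D2 Z2 _ U2] L12; split.
- by move=> f g bf bg; rewrite D1// D2//; ring.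
- by move=> c f bf; rewrite Z1// Z2//; ring.
- move=> f bf f0; rewrite mulr_ge0 ?invr_ge0 ?subr_ge0 ?(ltW l1)//.
  exact: L12.
- by rewrite U1 U2 mulr1 mulVf// subr_eq0 gt_eqF.
Qed.

End state_constructions.

(** * Weighted Cesaro averages of an ergodic measure *)

Lemma kernel_mass d (T : measurableType d) (R : realType)
    (m : {measure set T -> \bar R}) d' (Y : measurableType d')
    (k : T -> {measure set Y -> \bar R}) (A : set Y) : m setT = 1%E ->
  (forall x, k x setT = 1%E) ->
  (forall B, measurable B -> measurable_fun setT (k ^~ B)) -> measurable A ->
  (\int[m]_x k x A)%E = (mean m (fun x => mean (k x) \1_A))%:E.
Proof.
move=> m1 k1 mk mA; rewrite /Rintegral fineK.
  apply: eq_integral => x _; rewrite integral_indic// setIT fineK//.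
  exact: fin_num_mass1.
apply: integrable_fin_num => //; apply: (@bounded_measurable_integrable _ _ _ _ m1).
apply: bounded_measurable_kernel => //; exact: bounded_measurable_indic.
Qed.

Section ergodic_average.
Context (R : realType) (X : completePseudoMetricType R) (rho : X -> X -> R).
Context (P : R -> R.-pker (borel X) ~> (borel X)).
Hypotheses (pm : polish_metric rho) (mfP : markov_feller P).

Let P1 t x : P t x setT = 1%E.
Proof. exact: semigroup_mass1. Qed.

Let bP t f : bounded_measurable f ->
  bounded_measurable (fun x : borel X => mean (P t x) f).
Proof. exact: space_bounded_measurable. Qed.

(** Both sides are states in [f], so it is enough to compare them on indicators, where the identity
    is the semigroup law. *)
Lemma chapman_kolmogorov s r x (f : borel X -> R) : 0 <= s -> 0 <= r ->
  bounded_measurable f ->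
  mean (P s x) (fun y => mean (P r y) f) = mean (P (s + r) x) f.
Proof.
move=> s0 r0; move: f; apply: state_ext.
- apply: (@state_mean _ _ _ _ _ (P s x) (fun y f => mean (P r y) f)) => //.
    by move=> y; exact: mean_state.
  by move=> g; exact: bP.
- exact: mean_state.
- move=> A mA; rewrite (mean_indic _ mA).
  have [_ CK _ _] := mfP.
  rewrite CK// (kernel_mass _ _ _ mA)//.
  by move=> B mB; exact: measurable_kernel.
Qed.

Lemma invariant_mean (nu : probability (borel X) R) t (f : borel X -> R) :
  Defs.invariant P nu -> 0 <= t -> bounded_measurable f ->
  mean nu (fun x => mean (P t x) f) = mean nu f.
Proof.
move=> inv t0; have nu1 : nu setT = 1%E := probability_setT nu.
move: f; apply: state_ext.
- apply: (@state_mean _ _ _ _ _ nu (fun y f => mean (P t y) f)) => //.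
    by move=> y; exact: mean_state.
  by move=> g; exact: bP.
- exact: mean_state.
- move=> A mA; have := inv t t0 A mA; rewrite (kernel_mass _ _ _ mA)//; last first.
    by move=> B mB; exact: measurable_kernel.
  by move=> /(congr1 fine) /= ->; rewrite mean_indic.
Qed.

Lemma mean_invariant (nu : probability (borel X) R) :
  (forall t, 0 <= t -> forall f, bounded_measurable f ->
    mean nu (fun x => mean (P t x) f) = mean nu f) ->
  Defs.invariant P nu.
Proof.
move=> inv t t0 A mA; have nu1 : nu setT = 1%E := probability_setT nu.
rewrite (kernel_mass _ _ _ mA)//; last by move=> B mB; exact: measurable_kernel.
rewrite inv//; last exact: bounded_measurable_indic.
by rewrite mean_indic// fineK//; exact: fin_num_mass1.
Qed.

Lemma Qf_time_average t (f : X -> R) x :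
  Qf P t f x = time_average t (fun s => mean (P `|s| x) f).
Proof.
apply: (@eq_time_average _ t (fun s => mean (P s x) f)) => s s0.
by rewrite ger0_norm.
Qed.

Context (mu : probability (borel X) R) (phi : borel X -> R).
Hypotheses (bphi : bounded_measurable phi) (phi01 : forall x, 0 <= phi x <= 1).
Hypothesis c0 : 0 < mean mu phi.
Local Notation c := (mean mu phi).

Let mu1 : mu setT = 1%E. Proof. exact: probability_setT. Qed.

(** Expectation of [g] at time [|s|] when the initial law has density [phi / c] with respect to
    [mu]. *)
Let L (s : R) (g : borel X -> R) := c^-1 * mean mu (fun x => phi x * mean (P `|s| x) g).

Let state_L s : state (L s).
Proof.
apply: (@state_weighted _ _ _ mu phi _ _ (fun x g => mean (P `|s| x) g)) => //.
- by move=> x; case/andP: (phi01 x).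
- by move=> x; exact: mean_state.
- by move=> g; exact: bP.
Qed.

Let joint_phi g : bounded_measurable g -> bounded_measurable
  (fun p : measurableTypeR R * borel X => phi p.2 * mean (P `|p.1| p.2) g).
Proof.
move=> bg; apply: bounded_measurableM; last exact: (joint_bounded_measurable pm mfP).
exact: (@bounded_measurable_comp _ _ _ _ _ snd).
Qed.

Let bL g : bounded_measurable g ->
  bounded_measurable (fun s : measurableTypeR R => L s g).
Proof.
move=> bg; apply: bounded_measurableZ.
(* Only measurability in time is extracted, so any probability on the time axis would do. *)
by have [] := mean_fubini (uniform_prob (@ltr01 R)) mu (joint_phi bg).
Qed.

Definition weighted_average t (g : borel X -> R) : R :=
  time_average t (fun s => c^-1 * mean mu (fun x => phi x * mean (P `|s| x) g)).

Lemma weighted_average_state t : 0 < t -> state (weighted_average t).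
Proof.
move=> t0; have u1 : uniform_prob t0 setT = 1%E := probability_setT _.
have sU := @state_mean _ _ _ _ _ (uniform_prob t0) L u1 state_L bL.
have WE g : bounded_measurable g ->
    weighted_average t g = mean (uniform_prob t0) (fun s => L s g).
  by move=> bg; rewrite -(time_average_uniform t0 (bL bg)).
case: sU => D Z N U; split.
- move=> f g bf bg; rewrite !WE//; last exact: bounded_measurableD.
  exact: D.
- move=> a f bf; rewrite !WE//; last exact: bounded_measurableZ.
  exact: Z.
- by move=> f bf f0; rewrite WE//; exact: N.
- by rewrite WE//; exact: bounded_measurable_cst.
Qed.

(** At each time, [phi <= 1] and invariance bound the [mu]-integral of [phi * P_s g] by that of
    [g]. *)
Lemma weighted_average_le t g : Defs.invariant P mu -> 0 < t ->
  bounded_measurable g -> (forall x, 0 <= g x) ->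
  weighted_average t g <= c^-1 * mean mu g.
Proof.
move=> inv t0 bg g0; have u1 : uniform_prob t0 setT = 1%E := probability_setT _.
rewrite /weighted_average (time_average_uniform t0); last exact: bL.
rewrite -[leRHS](mean_cst u1); apply: le_mean => //.
- exact: bL.
- exact: bounded_measurable_cst.
- move=> s; rewrite ler_wpM2l ?invr_ge0 ?(ltW c0)//.
  rewrite -(invariant_mean inv (normr_ge0 s) bg).
  apply: le_mean => //; [|exact: bP|].
    by apply: bounded_measurableM => //; exact: bP.
  move=> x; have /andP[_ p1] := phi01 x.
  by rewrite ler_piMl//; apply: mean_ge0.
Qed.

(** By Chapman-Kolmogorov, applying [P r] to [g] shifts time by [r]. *)
Lemma weighted_average_shift t r M g : 0 < t -> 0 <= r ->
  bounded_measurable g -> (forall x, `|g x| <= M) ->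
  `|weighted_average t (fun x => mean (P r x) g) - weighted_average t g| <=
  t^-1 * (2 * (M * r)).
Proof.
move=> t0 r0 bg gM.
have -> : weighted_average t (fun x => mean (P r x) g) =
    time_average t (fun s => L (s + r) g).
  apply: eq_time_average => s s0; congr (_ * Rintegral _ _ _); apply/funext => x.
  by rewrite chapman_kolmogorov// !ger0_norm// addr_ge0.
apply: (time_average_shift (bL bg)) => // s.
exact: normr_state_le.
Qed.

(* By shift-invariance every ultralimit of the averages is an invariant
   probability [nu1] with [c * nu1 <= mu], so that [mu] is a proper convex
   combination of [nu1] and of another invariant probability. *)
Lemma weighted_average_cvg g : ergodic P mu -> bounded_measurable g ->
  weighted_average t g @[t --> +oo] --> mean mu g.
Proof.
move=> [inv extremal] bg; apply: cvg_ultra => U UU ooU.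
have U0 : \forall t \near U, 0 < t by apply: ooU; exact: nbhs_pinfty_gt.
have sA : \forall t \near U, state (weighted_average t).
  by apply: filterS U0 => t; exact: weighted_average_state.
have [cA sLam] := state_ultralim UU sA.
set Lam := (fun g => _) in sLam.
have dom f : bounded_measurable f -> (forall x, 0 <= f x) ->
    Lam f <= c^-1 * mean mu f.
  move=> bf f0; apply: limr_le; first exact: cA.
  by apply: filterS U0 => t t0; exact: weighted_average_le.
have invL r f : 0 <= r -> bounded_measurable f ->
    Lam (fun x => mean (P r x) f) = Lam f.
  move=> r0 bf; have [mf [M fM]] := bf.
  apply/eqP; rewrite -subr_eq0; apply/eqP.
  have d1 : weighted_average t (fun x => mean (P r x) f) - weighted_average t f
      @[t --> U] --> Lam (fun x => mean (P r x) f) - Lam f.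
    by apply: cvgB; apply: cA => //; exact: bP.
  rewrite -(cvg_lim _ d1)//; apply: cvg_lim => //.
  apply/cvgrPdist_le => e e0.
  (* Beyond this time the shift error [t^-1 * (2 * (M * r))] is at most [e]. *)
  have Ut : \forall t \near U, 2 * (M * r) / e <= t.
    by apply: ooU; exact: nbhs_pinfty_ge (num_real _).
  apply: filterS2 U0 Ut => t t0 te; rewrite sub0r normrN.
  apply: (le_trans (weighted_average_shift t0 r0 bf fM)).
  by rewrite ler_pdivrMl// -ler_pdivrMr.
have cLam : weighted_average t g @[t --> U] --> Lam g by exact: cA.
clearbody Lam.
(* Halving keeps the weight strictly below 1 even when [c = 1], and [l * Lam] is still dominated by
   [mu]. *)
pose l := c / 2.
have c1 : c <= 1.
  rewrite -(mean_cst mu1 1); apply: le_mean => //.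
    exact: bounded_measurable_cst.
  by move=> x; case/andP: (phi01 x).
have l01 : 0 < l < 1.
  by move: c0 c1; rewrite /l => h0 h1; apply/andP; split; lra.
have /andP[l0 l1] := l01.
have llam f : bounded_measurable f -> (forall x, 0 <= f x) ->
    l * Lam f <= mean mu f.
  move=> bf f0; apply: (@le_trans _ _ (c * Lam f)).
    apply: ler_wpM2r; last by move: c0; rewrite /l => h0; lra.
    by case: sLam => _ _ + _; exact.
  by rewrite -ler_pdivlMl// dom.
have [nu1 nu1E] := state_measure sLam dom.
have sLam2 := state_complement l01 sLam (mean_state mu1) llam.
(* The remainder is countably additive too: dropping the subtracted term [l * Lam] bounds it by
   [mu / (1 - l)]. *)
have [|nu2 nu2E] := @state_measure _ _ _ mu (1 - l)^-1 _ sLam2.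
  move=> f bf f0; rewrite ler_wpM2l//; first by rewrite invr_ge0 subr_ge0 ltW.
  rewrite gerBl mulr_ge0//; first exact: ltW.
  by case: sLam => _ _ + _; exact.
have inv1 : Defs.invariant P nu1.
  apply: mean_invariant => r r0 f bf.
  by rewrite (nu1E _ (bP r bf)) (nu1E _ bf) invL.
have inv2 : Defs.invariant P nu2.
  apply: mean_invariant => r r0 f bf.
  by rewrite (nu2E _ (bP r bf)) (nu2E _ bf) invL// invariant_mean.
have nu11 : nu1 setT = 1%E := probability_setT nu1.
have nu21 : nu2 setT = 1%E := probability_setT nu2.
have combo A : measurable A -> mu A = (l%:E * nu1 A + (1 - l)%:E * nu2 A)%E.
  move=> mA; have bA := bounded_measurable_indic R mA.
  rewrite -(fineK (fin_num_mass1 mu1 mA)) -(fineK (fin_num_mass1 nu11 mA)).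
  rewrite -(fineK (fin_num_mass1 nu21 mA)) -!EFinM -EFinD; congr EFin.
  rewrite -!mean_indic// (nu1E _ bA) (nu2E _ bA) mulrA divff ?mul1r; first by ring.
  by rewrite subr_eq0 gt_eqF.
have nu1mu : Lam g = mean mu g.
  apply: (state_ext sLam (mean_state mu1)) => // A mA.
  have [nuA _] := extremal nu1 nu2 l l01 inv1 inv2 combo A mA.
  rewrite -nu1E; last exact: bounded_measurable_indic.
  by rewrite !mean_indic//=; congr fine; exact: nuA.
by rewrite -nu1mu.
Qed.

(** Exchanging the time and space integrals exhibits the average as a [phi]-weighted mean of
    [Q_t f], the form to which eventual continuity applies. *)
Lemma weighted_average_fubini t (f : X -> R) : 0 < t ->
  bounded_measurable (f : borel X -> R) ->
  bounded_measurable (Qf P t f : borel X -> R) /\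
  weighted_average t f = c^-1 * mean mu (fun x => phi x * Qf P t f x).
Proof.
move=> t0 bf; have u1 : uniform_prob t0 setT = 1%E := probability_setT _.
have bjoint := joint_bounded_measurable pm mfP bf.
have QE x : Qf P t f x = mean (uniform_prob t0) (fun s => mean (P `|s| x) f).
  rewrite Qf_time_average (time_average_uniform t0)//.
  exact: time_bounded_measurable.
split.
  by rewrite (funext QE); have [] := mean_fubini (uniform_prob t0) mu bjoint.
have [b1 _ E] := mean_fubini (uniform_prob t0) mu (joint_phi bf).
rewrite /weighted_average (time_average_uniform t0); last exact: bL.
rewrite meanZ//= E; congr (_ * Rintegral _ _ _); apply/funext => x /=.
rewrite meanZ// ?QE//.
exact: time_bounded_measurable.
Qed.

End ergodic_average.

(** * Convergence at points of the support *)

Section convergence.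
Context (R : realType) (X : completePseudoMetricType R) (rho : X -> X -> R).
Context (P : R -> R.-pker (borel X) ~> (borel X)).
Context (mu : probability (borel X) R).
Hypotheses (pm : polish_metric rho) (mfP : markov_feller P).

Let mu1 : mu setT = 1%E. Proof. exact: probability_setT. Qed.

Lemma Qf_state t x : 0 < t -> @state _ (borel X) R (fun f => Qf P t f x).
Proof.
move=> t0; have u1 : uniform_prob t0 setT = 1%E := probability_setT _.
have bP f : bounded_measurable f -> bounded_measurable
    (fun s : measurableTypeR R => mean (P `|s| x) f).
  exact: time_bounded_measurable.
have QE (f : X -> R) : bounded_measurable (f : borel X -> R) ->
    Qf P t f x = mean (uniform_prob t0) (fun s => mean (P `|s| x) f).
  by move=> bf; rewrite Qf_time_average -(time_average_uniform t0 (bP f bf)).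
have [] := @state_mean _ _ _ _ _ (uniform_prob t0)
  (fun s f => mean (P `|s| x) f) u1 _ bP.
  by move=> s; apply: mean_state; exact: semigroup_mass1.
move=> D Z N U; split.
- move=> f g bf bg; rewrite !QE//; last exact: bounded_measurableD.
  exact: D.
- move=> a f bf; rewrite !QE//; last exact: bounded_measurableZ.
  exact: Z.
- by move=> f bf f0; rewrite QE//; exact: N.
- by rewrite QE//; exact: bounded_measurable_cst.
Qed.

(** An infimum of suprema lies below [e] only if one of the suprema does; this is used once in space
    and once in time. The time threshold depends on [y]. *)
Lemma cesaro_ev_continuousP (x : X) (f : X -> R) (e : R) :
  cesaro_ev_continuous rho P x -> bounded_lipschitz rho f -> 0 < e ->
  \forall y \near x, \forall t \near +oo, `|Qf P t f y - Qf P t f x| < e.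
Proof.
move=> cx lf e0; have := cx f lf => E.
have : (limf_esup (fun y => limf_esup
    (fun t => `|Qf P t f y - Qf P t f x|%:E) (pinfty_nbhs R)) (nbhs x) < e%:E)%E.
  by rewrite E lte_fin.
move=> /ereal_inf_lt[_ [V xV <-] Ve]; apply: filterS xV => y Vy.
have : (limf_esup (fun t => `|Qf P t f y - Qf P t f x|%:E) (pinfty_nbhs R) < e%:E)%E.
  by apply: le_lt_trans Ve; apply: ereal_sup_ubound; exists y.
move=> /ereal_inf_lt[_ [A ooA <-] Ae]; apply: filterS ooA => t At.
rewrite -lte_fin; apply: le_lt_trans Ae; apply: ereal_sup_ubound.
by exists t.
Qed.

(* [k] is the part of the deviation from [Q_t f x] exceeding [e]; it tends to 0
   pointwise, so that the averages of [Q_t f] over a small neighbourhood of [x]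
   are eventually [2e]-close to [Q_t f x]. *)
Lemma lipschitz_cvg (x : X) (f : X -> R) :
  cesaro_ev_continuous rho P x -> ergodic P mu -> supp mu x ->
  bounded_lipschitz rho f -> Qf P t f x @[t --> +oo] --> mean mu f.
Proof.
move=> cx erg sx lf.
have bf := continuous_bounded_measurable (lipschitz_continuous pm lf).
have [mf [M fM]] := bf.
(* Passing to sequences of times makes dominated convergence applicable. *)
apply/cvg_pinftyP => v voo.
(* The maximum makes every time positive, so that each average is a state; eventually it equals
   [v n]. *)
pose u n := Num.max 1 (v n).
have u0 n : 0 < u n by rewrite lt_max ltr01.
have uoo : u n @[n --> \oo] --> +oo.
  apply/cvgryPge => A; near=> n; rewrite le_max; apply/orP; right.
  by near: n; move/cvgryPge : voo; apply.
have uv : \forall n \near \oo, u n = v n.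
  near=> n; apply/max_idPr.
  by near: n; move/cvgryPge : voo; apply.
suff : Qf P (u n) f x @[n --> \oo] --> mean mu f.
  apply: cvg_trans; apply: near_eq_cvg.
  by apply: filterS uv => n ->.
apply/cvgrPdist_le => e e0; pose e3 := e / 3.
have e30 : 0 < e3 by rewrite divr_gt0.
have Vx := cesaro_ev_continuousP cx lf e30.
(* The interior is open, hence Borel, and still contains [x], so it has positive mass because [x]
   lies in the support. *)
set V := (fun y => _) in Vx; pose B : set X := V^°.
have oB : open B by exact: open_interior.
have mB : measurable (B : set (borel X)) by exact: sub_sigma_algebra.
pose phi : borel X -> R := \1_B.
have bphi : bounded_measurable phi by exact: bounded_measurable_indic.
have phi01 y : 0 <= phi y <= 1.
  by rewrite /phi indicE; case: (_ \in _); rewrite ?lexx ?ler01.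
have c0 : 0 < mean mu phi.
  rewrite mean_indic// fine_gt0// (sx B oB Vx)/=.
  by rewrite -ge0_fin_numE//; exact: fin_num_mass1.
have fub n := weighted_average_fubini pm mfP mu bphi (u0 n) bf.
have QM n y : `|Qf P (u n) f y| <= M.
  exact: (normr_state_le (Qf_state y (u0 n)) bf fM).
pose dev n y := `|Qf P (u n) f y - Qf P (u n) f x|.
have bdev n : bounded_measurable (dev n : borel X -> R).
  apply/bounded_measurable_norm/bounded_measurableB; first by case: (fub n).
  exact: bounded_measurable_cst.
have devM n y : dev n y <= 2 * M.
  by rewrite mulr2n mulrDl mul1r (le_trans (ler_normB _ _))// lerD.
pose k n y := phi y * Num.max (dev n y - e3) 0.
have k_ge0 n y : 0 <= k n y.
  by case/andP: (phi01 y) => ? _; rewrite mulr_ge0// le_max lexx orbT.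
have kM n y : `|k n y| <= 2 * M.
  have d0 : 0 <= dev n y by exact: normr_ge0.
  rewrite ger0_norm//; case/andP: (phi01 y) => p0 p1.
  apply: (@le_trans _ _ (1 * dev n y)); last by rewrite mul1r.
  apply: ler_pM => //; first by rewrite le_max lexx orbT.
  by rewrite ge_max d0 andbT gerBl ltW.
have mk n : measurable_fun setT (k n : borel X -> R).
  apply: measurable_funM; first by case: bphi.
  apply: measurable_maxr; last exact: measurable_cst.
  by apply: measurable_funB; [case: (bdev n)|exact: measurable_cst].
have bk n : bounded_measurable (k n : borel X -> R) by split => //; exists (2 * M).
(* For [y] in [B] the deviation eventually drops below [e3], so [k n y] is eventually 0; elsewhere
   [phi] vanishes. The dominating constant is [2 * M]. *)
have k0 : mean mu (k n) @[n --> \oo] --> 0.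
  rewrite -[X in _ --> X](mean_cst mu1 0).
  apply: (mean_cvg mu1 mk kM) => y.
  have [yB|yB] := boolP (y \in (B : set X)); last first.
    rewrite (_ : k ^~ y = fun=> 0); first exact: cvg_cst.
    by apply/funext => n; rewrite /k /phi indicE (negbTE yB) mul0r.
  have Vy : V y by apply: interior_subset; exact: set_mem.
  apply: (@cvg_trans _ ((fun _ : nat => 0 : R) @ \oo)); last exact: cvg_cst.
  apply: near_eq_cvg; have : \forall n \near \oo, dev n y < e3 by exact: (uoo _ Vy).
  apply: filterS => n dn; rewrite /k (_ : Num.max _ _ = 0) ?mulr0//.
  by apply/max_idPr; rewrite subr_le0 ltW.
(* Writing the constants [Q_t f x] and [e3] as [phi]-averages reduces this to the pointwise bound
   [phi * dev <= e3 * phi + k]. *)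
have close n : `|weighted_average P mu phi (u n) f - Qf P (u n) f x| <=
    e3 + (mean mu phi)^-1 * mean mu (k n).
  have [bQ ->] := fub n; pose q := Qf P (u n) f x.
  have bpQ : bounded_measurable (fun y => phi y * Qf P (u n) f y).
    exact: bounded_measurableM.
  have bpq := bounded_measurableZ q bphi.
  have -> : Qf P (u n) f x = (mean mu phi)^-1 * mean mu (fun y => q * phi y).
    by rewrite meanZ// mulrC mulfK// gt_eqF.
  have -> : e3 = (mean mu phi)^-1 * mean mu (fun y => e3 * phi y).
    by rewrite meanZ// mulrC mulfK// gt_eqF.
  have bep := bounded_measurableZ e3 bphi.
  rewrite -mulrBr -mulrDr normrM ger0_norm ?invr_ge0 ?(ltW c0)//.
  rewrite ler_wpM2l ?invr_ge0 ?(ltW c0)//.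
  rewrite -meanB// -meanD//.
  have bdiff := bounded_measurableB bpQ bpq.
  apply: le_trans (le_normr_Rintegral _ _) _ => //.
    exact: bounded_measurable_integrable.
  apply: le_mean => //.
  - exact: bounded_measurable_norm.
  - exact: bounded_measurableD.
  - move=> y; rewrite (mulrC q) -mulrBr normrM -/(dev n y) (mulrC e3) -mulrDr.
    case/andP: (phi01 y) => p0 _; rewrite ger0_norm// ler_wpM2l//.
    by rewrite -lerBlDl le_max lexx.
have /cvgrPdist_le wa : weighted_average P mu phi (u n) f @[n --> \oo] --> mean mu f.
  have W := weighted_average_cvg pm mfP bphi phi01 c0 erg bf.
  exact: (cvg_comp u (fun t => weighted_average P mu phi t f) uoo W).
have /cvgrPdist_le ck : (mean mu phi)^-1 * mean mu (k n) @[n --> \oo] --> 0.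
  rewrite -[X in _ --> X](mulr0 (mean mu phi)^-1).
  by apply: cvgM => //; exact: cvg_cst.
near=> n; have cl := close n.
have w1 : `|mean mu f - weighted_average P mu phi (u n) f| <= e3.
  by near: n; exact: wa.
have w2 : (mean mu phi)^-1 * mean mu (k n) <= e3.
  have : `|0 - (mean mu phi)^-1 * mean mu (k n)| <= e3 by near: n; exact: ck.
  by rewrite sub0r normrN; apply: le_trans; exact: ler_norm.
apply: le_trans (ler_distD (weighted_average P mu phi (u n) f) _ _) _.
apply: (@le_trans _ _ (e3 + (e3 + e3))).
  by rewrite lerD// (le_trans cl)// lerD.
by rewrite /e3; lra.
Unshelve. all: by end_near.
Qed.

(** A Lipschitz minorant [F k] whose [mu]-integral is within [e / 2] of that of [f] suffices:
    [Q_t f] dominates [Q_t (F k)], which converges. *)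
Lemma Qf_liminf (x : X) (f : X -> R) (M e : R) :
  (forall z, cesaro_ev_continuous rho P z) -> ergodic P mu -> supp mu x ->
  bounded_continuous f -> (forall y, 0 <= f y <= M) -> 0 < e ->
  \forall t \near +oo, mean mu f - e <= Qf P t f x.
Proof.
move=> ces erg sx cf fM e0; have [cf' _] := cf.
have [] := @lsc_lipschitz_approx _ _ _ pm f M fM.
  move=> z r r0; have /cvgrPdist_lt/(_ r r0) := cf' z.
  by apply: filterS => y; rewrite ltr_norml => /andP[_]; lra.
move=> F [lF F0f Ff].
have bf := continuous_bounded_measurable cf.
have bF k := continuous_bounded_measurable (lipschitz_continuous pm (lF k)).
have FM k y : `|F k y| <= M.
  have /andP[F0 Ffy] := F0f k y; rewrite ger0_norm// (le_trans Ffy)//.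
  by case/andP: (fM y).
have mF : mean mu (F k) @[k --> \oo] --> mean mu f.
  by apply: (mean_cvg mu1 _ FM) => //; move=> k; case: (bF k).
have e20 : 0 < e / 2 by rewrite divr_gt0.
have [k hk] : exists k, `|mean mu f - mean mu (F k)| < e / 2.
  have /cvgrPdist_lt/(_ _ e20)[k _ hk] := mF.
  by exists k; exact: (hk k (leqnn k)).
have /cvgrPdist_lt/(_ _ e20) Qk := lipschitz_cvg (ces x) erg sx (lF k).
near=> t; have t0 : 0 < t by near: t; exact: nbhs_pinfty_gt.
apply: (@le_trans _ _ (Qf P t (F k) x)); last first.
  apply: (le_state (Qf_state x t0) (bF k) bf) => y.
  by case/andP: (F0f k y).
have : `|mean mu (F k) - Qf P t (F k) x| < e / 2 by near: t; exact: Qk.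
move: hk; rewrite !ltr_norml => /andP[_ h1] /andP[_ h2].
lra.
Unshelve. all: by end_near.
Qed.

End convergence.

Theorem theorem3p2 (R : realType) (X : completePseudoMetricType R)
    (rho : X -> X -> R) (P : R -> R.-pker (borel X) ~> (borel X))
    (mu : probability (borel X) R) :
  polish_metric rho ->
  markov_feller P ->
  (forall z : X, cesaro_ev_continuous rho P z) ->
  ergodic P mu ->
  forall x : X, supp mu x ->
  forall f : X -> R, bounded_continuous f ->
    Qf P t f x @[t --> +oo] --> Rintegral mu [set: borel X] f.
Proof.
move=> pm mfP ces erg x sx f cf; have [cf' [M fM]] := cf.
have mu1 : mu setT = 1%E := probability_setT mu.
have bf := continuous_bounded_measurable cf.
have bM := bounded_measurable_cst (borel X) M.
have fNM y : - M <= f y <= M by rewrite -ler_norml.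
have cM : continuous (fun _ : X => M) by move=> y; exact: cvg_cst.
(* Both [f + M] and [M - f] take values between 0 and [M + M]; their lower bounds give, after
   cancelling [M], the lower and upper bounds for [f]. *)
have cfM : bounded_continuous (fun y => f y + M).
  split; first by move=> y; apply: cvgD; [exact: cf'|exact: cM].
  by exists (M + M) => y; have := fNM y; rewrite ler_norml => /andP[? ?]; lra.
have cMf : bounded_continuous (fun y => M - f y).
  split; first by move=> y; apply: cvgB; [exact: cM|exact: cf'].
  by exists (M + M) => y; have := fNM y; rewrite ler_norml => /andP[? ?]; lra.
apply/cvgrPdist_le => e e0.
have lo := @Qf_liminf _ _ _ _ mu pm mfP x _ (M + M) e ces erg sx cfM.
have hi := @Qf_liminf _ _ _ _ mu pm mfP x _ (M + M) e ces erg sx cMf.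
have {}lo := lo ltac:(by move=> y; have /andP[? ?] := fNM y; lra) e0.
have {}hi := hi ltac:(by move=> y; have /andP[? ?] := fNM y; lra) e0.
have pos : \forall t \near +oo, 0 < t :> R by exact: nbhs_pinfty_gt.
apply: filterS3 lo hi pos => t.
move=> h1 h2 t0; have sQ := Qf_state mfP x t0; have [QD _ _ _] := sQ.
move: h1 h2; rewrite meanB// meanD// mean_cst//.
rewrite (QD f (fun=> M) bf bM) (stateB sQ bM bf) (state_cst M sQ).
by rewrite ler_norml => h1 h2; apply/andP; split; lra.
Qed.
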